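(* Let $F\in\mathbb Z[x]$, $x=(x_1,\dots,x_n)$. For a prime number $p$ denote by $F_p$ the image of $F$ in $\mathbb F_p[[x]]$, and by $F_0$ the image of $F$ in $\mathbb Q[[x]]$. (1) Let $p$ be a prime number. If $\mu(F_p)$ is finite, then $\mu(F_p)\ge\mu(F_0)$, and $\mu(F_p)\ge\mu(F_q)$ for all except finitely many prime numbers $q$. In particular, if $\mu(F_p)$ is finite for some $p$, then $\mu(F_0)$ is finite. (2) If $\mu(F_0)$ is finite, then $\mu(F_0)\ge\mu(F_q)$ (and hence $\mu(F_0)=\mu(F_q)$) for all except finitely many prime numbers $q$. The same statements hold with the Tjurina number $\tau$ in place of $\mu$.
   Context: For a field $\Bbbk$ and $f\in\Bbbk[[x]]$, with $j(f)=\langle\partial f/\partial x_1,\dots,\partial f/\partial x_n\rangle$, the Milnor number is $\mu(f)=\dim_{\Bbbk}\Bbbk[[x]]/j(f)$ and the Tjurina number is $\tau(f)=\dim_{\Bbbk}\Bbbk[[x]]/\langle f,j(f)\rangle$, both in $\mathbb N\cup\{\infty\}$. *)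

(* Defs.v *)
From HB Require Import structures.
From mathcomp Require Import all_boot all_order all_algebra.
From mathcomp Require Import boolp classical_sets functions cardinality.
From mathcomp Require Import mpoly.

Set Implicit Arguments.
Unset Strict Implicit.
Unset Printing Implicit Defensive.

Import GRing.Theory.
Local Open Scope ring_scope.
Local Open Scope quotient_scope.

(* A record rather than a bare function type, so that the pointwise product
   which [functions] puts on function types is never inferred. *)
Record mpseries (n : nat) (R : Type) := MPSeries {
  mpscoef : 'X_{1..n} -> R
}.

Section SeriesZmodule.
Variables (n : nat) (R : zmodType).
Local Notation S := (mpseries n R).
Implicit Types f g h : S.

Lemma mpseriesP f g : (forall m, mpscoef f m = mpscoef g m) <-> f = g.
Proof.
split=> [|-> //]; case: f g => [f] [g] /= fg.
by congr MPSeries; apply: funext.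
Qed.

HB.instance Definition _ := gen_eqMixin S.
HB.instance Definition _ := gen_choiceMixin S.

Definition mps_zero : S := MPSeries (fun=> 0).
Definition mps_opp f : S := MPSeries (fun m => - mpscoef f m).
Definition mps_add f g : S := MPSeries (fun m => mpscoef f m + mpscoef g m).

Lemma mps_addA : associative mps_add.
Proof. by move=> f g h; apply/mpseriesP => m /=; rewrite addrA. Qed.
Lemma mps_addC : commutative mps_add.
Proof. by move=> f g; apply/mpseriesP => m /=; rewrite addrC. Qed.
Lemma mps_add0 : left_id mps_zero mps_add.
Proof. by move=> f; apply/mpseriesP => m /=; rewrite add0r. Qed.
Lemma mps_addN : left_inverse mps_zero mps_opp mps_add.
Proof. by move=> f; apply/mpseriesP => m /=; rewrite addNr. Qed.

HB.instance Definition _ :=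
  GRing.isZmodule.Build S mps_addA mps_addC mps_add0 mps_addN.

End SeriesZmodule.

Section SeriesRing.
Variables (n : nat) (R : comNzRingType).
Local Notation S := (mpseries n R).
Implicit Types (f g h : S) (m : 'X_{1..n}).

Definition mps_one : S := MPSeries (fun m => (m == 0%MM)%:R).

(* The bound on the degrees only makes the index type finite: both factors of
   [m] have degree at most [mdeg m]. *)
Definition mps_mul f g : S := MPSeries (fun m =>
  \sum_(k : 'X_{1..n < (mdeg m).+1, (mdeg m).+1} | m == (k.1 + k.2)%MM)
    mpscoef f k.1 * mpscoef g k.2).

Definition mps_trunc (d : nat) f : {mpoly R[n]} :=
  \sum_(m : 'X_{1..n < d}) mpscoef f m *: 'X_[m].

Lemma mcoeff_trunc d f m : (mdeg m < d)%N -> (mps_trunc d f)@_m = mpscoef f m.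
Proof. exact: (mcoeff_mpoly (mpscoef f)). Qed.

Lemma mps_mul_poly d f g (p q : {mpoly R[n]}) m : (mdeg m < d)%N ->
  (forall m', (mdeg m' < d)%N -> p@_m' = mpscoef f m') ->
  (forall m', (mdeg m' < d)%N -> q@_m' = mpscoef g m') ->
  mpscoef (mps_mul f g) m = (p * q)@_m.
Proof.
move=> md pf qg; rewrite mcoeffM /=; apply: eq_bigr => -[k1 k2] /= _.
by rewrite pf ?qg // (leq_trans (bmdeg _) md).
Qed.

Lemma mps_mulA : associative mps_mul.
Proof.
move=> f g h; apply/mpseriesP => m.
pose T := mps_trunc (mdeg m).+1.
have TE u m' : (mdeg m' < (mdeg m).+1)%N -> (T u)@_m' = mpscoef u m'.
  exact: mcoeff_trunc.
have TM u v m' : (mdeg m' < (mdeg m).+1)%N ->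
    (T u * T v)@_m' = mpscoef (mps_mul u v) m'.
  by move=> lt; rewrite (mps_mul_poly lt (TE u) (TE v)).
rewrite (mps_mul_poly (ltnSn _) (TE f) (TM g h)).
by rewrite (mps_mul_poly (ltnSn _) (TM f g) (TE h)) mulrA.
Qed.

Lemma mps_mulC : commutative mps_mul.
Proof.
move=> f g; apply/mpseriesP => m.
have TE u := fun m' => @mcoeff_trunc (mdeg m).+1 u m'.
by rewrite !(mps_mul_poly (ltnSn _) (TE _) (TE _)) mulrC.
Qed.

Lemma mps_mul1 : left_id mps_one mps_mul.
Proof.
move=> f; apply/mpseriesP => m.
have TE u := fun m' => @mcoeff_trunc (mdeg m).+1 u m'.
have OE m' : (mdeg m' < (mdeg m).+1)%N ->
  (1 : {mpoly R[n]})@_m' = mpscoef mps_one m' by rewrite mcoeff1.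
by rewrite (mps_mul_poly (ltnSn _) OE (TE _)) mul1r TE.
Qed.

Lemma mps_mulD : left_distributive mps_mul +%R.
Proof.
move=> f g h; apply/mpseriesP => m /=; rewrite -big_split /=.
by apply: eq_bigr => k _; rewrite mulrDl.
Qed.

Lemma mps_one_neq0 : mps_one != 0.
Proof.
apply/eqP => /mpseriesP/(_ 0%MM) /= /eqP.
by rewrite eqxx oner_eq0.
Qed.

HB.instance Definition _ := GRing.Zmodule_isComNzRing.Build S
  mps_mulA mps_mulC mps_mul1 mps_mulD mps_one_neq0.

Definition mps_scale (a : R) f : S := MPSeries (fun m => a * mpscoef f m).

Lemma mps_scaleA a b f : mps_scale a (mps_scale b f) = mps_scale (a * b) f.
Proof. by apply/mpseriesP => m /=; rewrite mulrA. Qed.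
Lemma mps_scale1 : left_id 1 mps_scale.
Proof. by move=> f; apply/mpseriesP => m /=; rewrite mul1r. Qed.
Lemma mps_scaleDr : right_distributive mps_scale +%R.
Proof. by move=> a f g; apply/mpseriesP => m /=; rewrite mulrDr. Qed.
Lemma mps_scaleDl f : {morph mps_scale^~ f : a b / a + b}.
Proof. by move=> a b; apply/mpseriesP => m /=; rewrite mulrDl. Qed.

HB.instance Definition _ := GRing.Zmodule_isLmodule.Build R S
  mps_scaleA mps_scale1 mps_scaleDr mps_scaleDl.

Lemma mps_scaleAl (a : R) f g : a *: (f * g) = a *: f * g.
Proof.
apply/mpseriesP => m /=; rewrite mulr_sumr.
by apply: eq_bigr => k _; rewrite mulrA.
Qed.

HB.instance Definition _ := GRing.Lmodule_isLalgebra.Build R S mps_scaleAl.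
HB.instance Definition _ := GRing.Lalgebra_isComAlgebra.Build R S.

Definition mps_of_mpoly (p : {mpoly R[n]}) : S := MPSeries (fun m => p@_m).

Definition mps_deriv (i : 'I_n) f : S :=
  MPSeries (fun m => mpscoef f (m + U_(i))%MM *+ (m i).+1).

End SeriesRing.

Section IdealSpan.
Variables (R : comNzRingType) (A : comAlgType R) (gs : seq A).

Definition ideal_span : {pred A} := fun x : A =>
  `[< exists c : 'I_(size gs) -> A, x = \sum_i c i * gs`_i >].

Lemma ideal_span_submod : submod_closed ideal_span.
Proof.
split=> [|a x y].
  by apply/asboolP; exists (fun=> 0); rewrite big1 // => i _; rewrite mul0r.
move=> /asboolP[c ->] /asboolP[d ->].
apply/asboolP; exists (fun i => a *: c i + d i).
rewrite scaler_sumr -big_split /=; apply: eq_bigr => i _.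
by rewrite mulrDl scalerAl.
Qed.

HB.instance Definition _ :=
  GRing.isSubmodClosed.Build R A ideal_span ideal_span_submod.

End IdealSpan.

Section IdealQuotient.
Variables (R : comNzRingType) (A : comAlgType R) (gs : seq A).
Local Notation I := (ideal_span gs).
Local Notation pi := (\pi_(Quotient.quot I)).

(* The library's ring structure on quotients needs a proper ideal. The additive
   quotient does not, and covers the unit ideal, whose quotient is zero. *)
Definition quot_ideal : Type := Quotient.quot I.
HB.instance Definition _ := GRing.Zmodule.on quot_ideal.

Definition quot_ideal_scale (a : R) (x : quot_ideal) : quot_ideal :=
  pi (a *: repr x).

Lemma quot_ideal_scale_pi (a : R) (v : A) :
  quot_ideal_scale a (pi v) = pi (a *: v).
Proof.
apply/eqP; rewrite /quot_ideal_scale -Quotient.idealrBE -scalerBr rpredZ //.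
by rewrite Quotient.idealrBE reprK.
Qed.

Lemma quot_ideal_pi_surj (x : quot_ideal) : exists v : A, x = pi v.
Proof. by exists (repr x); rewrite reprK. Qed.

Lemma quot_ideal_scaleA (a b : R) x :
  quot_ideal_scale a (quot_ideal_scale b x) = quot_ideal_scale (a * b) x.
Proof.
by have [v ->] := quot_ideal_pi_surj x; rewrite !quot_ideal_scale_pi scalerA.
Qed.

Lemma quot_ideal_scale1 : left_id 1 quot_ideal_scale.
Proof.
move=> x; have [v ->] := quot_ideal_pi_surj x.
by rewrite quot_ideal_scale_pi scale1r.
Qed.

Lemma quot_ideal_scaleDr : right_distributive quot_ideal_scale +%R.
Proof.
move=> a x y; have [v ->] := quot_ideal_pi_surj x.
have [w ->] := quot_ideal_pi_surj y.
rewrite !quot_ideal_scale_pi -[X in quot_ideal_scale _ X](raddfD pi).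
by rewrite quot_ideal_scale_pi scalerDr raddfD.
Qed.

Lemma quot_ideal_scaleDl x : {morph quot_ideal_scale^~ x : a b / a + b}.
Proof. by move=> a b; rewrite /quot_ideal_scale scalerDl raddfD. Qed.

HB.instance Definition _ := GRing.Zmodule_isLmodule.Build R quot_ideal
  quot_ideal_scaleA quot_ideal_scale1 quot_ideal_scaleDr quot_ideal_scaleDl.

End IdealQuotient.

Variant enat := Fin of nat | Infty.

Definition enat_le (a b : enat) : bool :=
  match a, b with
  | _, Infty => true
  | Infty, Fin _ => false
  | Fin m, Fin n => (m <= n)%N
  end.

Definition is_basis (k : fieldType) (V : lmodType k) (d : nat)
    (e : 'I_d -> V) : Prop :=
  (forall c : 'I_d -> k, \sum_i c i *: e i = 0 -> forall i, c i = 0) /\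
  (forall v, exists c : 'I_d -> k, v = \sum_i c i *: e i).

Definition has_dim (k : fieldType) (V : lmodType k) (d : nat) : Prop :=
  exists e : 'I_d -> V, is_basis e.

Definition lmod_dim (k : fieldType) (V : lmodType k) : enat :=
  match pselect (exists d, has_dim V d) with
  | left ex => Fin (projT1 (cid ex))
  | right _ => Infty
  end.

Section Dimension.
Variables (k : fieldType) (V : lmodType k).

Lemma basis_size_le d d' (e : 'I_d -> V) (e' : 'I_d' -> V) :
  is_basis e -> is_basis e' -> (d' <= d)%N.
Proof.
move=> [_ /choice[C spe]] [fre' _].
pose M : 'M[k]_(d', d) := \matrix_(i, j) C (e' i) j.
suff: row_free M by move=> /eqP <-; exact: rank_leq_col.
rewrite -kermx_eq0; apply/eqP/row_matrixP => r; rewrite row0.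
set u := row r _.
have uM : u *m M = 0 by apply/sub_kermxP; exact: row_sub.
have/fre' u0 : \sum_i u 0 i *: e' i = 0.
  transitivity (\sum_j (u *m M) 0 j *: e j); last first.
    by rewrite uM big1 // => j _; rewrite mxE scale0r.
  under eq_bigr do rewrite [e' _]spe scaler_sumr.
  rewrite exchange_big; apply: eq_bigr => j _ /=.
  rewrite mxE scaler_suml; apply: eq_bigr => i _.
  by rewrite [M i j]mxE scalerA.
by apply/rowP => i; rewrite u0 mxE.
Qed.

Lemma lmod_dimE d : has_dim V d -> lmod_dim V = Fin d.
Proof.
rewrite /lmod_dim => -[e be]; case: pselect => [ex|]; last by case; exists d, e.
case: cid => d' [e' be'] /=; congr Fin; apply/eqP.
by rewrite eqn_leq (basis_size_le be be') (basis_size_le be' be).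
Qed.

End Dimension.

Section Invariants.
Variables (k : fieldType) (n : nat) (f : mpseries n k).

Definition partials : seq (mpseries n k) := [seq mps_deriv i f | i : 'I_n].

Definition milnor : enat := lmod_dim (quot_ideal partials).

Definition tjurina : enat := lmod_dim (quot_ideal (f :: partials)).

End Invariants.

Definition series_image (k : fieldType) (n : nat) (F : {mpoly int[n]}) :
    mpseries n k :=
  mps_of_mpoly (map_mpoly intr F).

(* Main.v *)
Require Import Defs.
From HB Require Import structures.
From mathcomp Require Import all_boot all_order all_algebra.
From mathcomp Require Import boolp classical_sets functions cardinality.
From mathcomp Require Import mpoly zify.

(* For generators in Z[x] and a field k, let I be the ideal they generate in
   k[[x]] and m the maximal ideal. The dimension c_d(k) of k[[x]]/(I + m^d) is
   the number of monomials of degree < d minus the rank over k of an integer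
   matrix independent of k. Comparing minors, c_d(Q) <= c_d(k), with equality
   for k = F_q and almost all q. Moreover c_d is nondecreasing in d, is bounded
   by dim k[[x]]/I, and c_d = c_(d+1) forces m^d to lie in I by Nakayama, so that
   c_d = dim k[[x]]/I. Hence a bound D on dim F_p[[x]]/I bounds all c_d(Q), which
   must then be stationary at some d; and only the two ranks at this d and at
   d + 1 matter when comparing Q with F_q. *)

Set Implicit Arguments.
Unset Strict Implicit.
Unset Printing Implicit Defensive.

Import Order.TTheory GRing.Theory Num.Theory.
Local Open Scope ring_scope.
Local Open Scope quotient_scope.

(** * Ranks of an integer matrix over different fields *)

Section Minors.

(** Choose a maximal independent set of rows, then as many independent columns of the submatrix they
    form. *)
Lemma exists_minor_rank (k : fieldType) (m n : nat) (M : 'M[k]_(m, n)) :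
  exists f g, \det (mxsub f g M : 'M_(\rank M)) != 0.
Proof.
have full : row_full (rowsub (maxrankfun M) M)^T.
  by rewrite /row_full mxrank_tr; exact: maxrowsub_free.
exists (maxrankfun M), (fullrankfun full).
have := fullrowsub_unit full.
rewrite unitmxE unitfE -det_tr; congr (\det _ != 0).
by apply/matrixP => i j; rewrite !mxE.
Qed.

(** An invertible submatrix has rank [r], and neither of the two extractions, of rows and of
    columns, can raise the rank. *)
Lemma minor_leq_rank (k : fieldType) (m n r : nat) (M : 'M[k]_(m, n)) f g :
  \det (mxsub f g M : 'M_r) != 0 -> (r <= \rank M)%N.
Proof.
rewrite -unitfE -unitmxE => /mxrank_unit <-.
have -> : mxsub f g M = rowsub f (rowsub g M^T)^T.
  by apply/matrixP => i j; rewrite !mxE.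
apply: leq_trans (mxrankS (rowsub_sub _ _)) _.
by rewrite mxrank_tr -(mxrank_tr M) mxrankS ?rowsub_sub.
Qed.

Lemma det_minor_intr (k : fieldType) (m n r : nat) (M : 'M[int]_(m, n)) f g :
  \det (mxsub f g (map_mx intr M) : 'M[k]_r) = (\det (mxsub f g M))%:~R.
Proof. by rewrite -det_map_mx map_mxsub. Qed.

(** A minor that is nonzero in [k] is the image of an integer minor, which is then a nonzero integer
    and stays nonzero in the rationals. *)
Lemma rank_intr_le (k : fieldType) (m n : nat) (M : 'M[int]_(m, n)) :
  (\rank (map_mx intr M : 'M[k]_(m, n)) <=
   \rank (map_mx intr M : 'M[rat]_(m, n)))%N.
Proof.
have [f [g]] := exists_minor_rank (map_mx intr M : 'M[k]_(m, n)).
rewrite det_minor_intr => nz; apply: (@minor_leq_rank _ _ _ _ _ f g).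
rewrite det_minor_intr intr_eq0; apply: contraNneq nz => ->.
by rewrite mulr0z.
Qed.

Lemma intr_Fp_eq0 (p : nat) (z : int) :
  prime p -> (z%:~R == 0 :> 'F_p) = (p %| `|z|)%N.
Proof.
move=> pp; rewrite (dvdn_pcharf (pchar_Fp pp)).
by case: z => z; rewrite ?NegzE ?mulrNz ?oppr_eq0 ?abszN.
Qed.

(** One nonzero integer minor of the size of the rational rank suffices: it survives modulo every
    prime larger than its absolute value, which serves as [B]. *)
Lemma rank_Fp_rat (m n : nat) (M : 'M[int]_(m, n)) :
  exists B : nat, forall p, prime p -> (B < p)%N ->
    \rank (map_mx intr M : 'M['F_p]_(m, n)) =
    \rank (map_mx intr M : 'M[rat]_(m, n)).
Proof.
have [f [g]] := exists_minor_rank (map_mx intr M : 'M[rat]_(m, n)).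
rewrite det_minor_intr intr_eq0; set z := \det _ => nz.
exists `|z|%N => p pp ltp; apply/eqP; rewrite eqn_leq rank_intr_le /=.
apply: (@minor_leq_rank _ _ _ _ _ f g).
rewrite det_minor_intr intr_Fp_eq0 // -/z.
by apply/negP => /dvdn_leq; rewrite absz_gt0 leqNgt ltp => /(_ nz).
Qed.

End Minors.

(** * Coefficients, truncations and units of power series *)

Section Series.
Variables (n : nat) (R : comNzRingType).
Local Notation S := (mpseries n R).
Implicit Types (f g h : S) (m : 'X_{1..n}).

Lemma mpscoef0 m : mpscoef (0 : S) m = 0.
Proof. by []. Qed.

Lemma mpscoefD f g m : mpscoef (f + g) m = mpscoef f m + mpscoef g m.
Proof. by []. Qed.

Lemma mpscoefB f g m : mpscoef (f - g) m = mpscoef f m - mpscoef g m.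
Proof. by []. Qed.

Lemma mpscoefZ a f m : mpscoef (a *: f) m = a * mpscoef f m.
Proof. by []. Qed.

Lemma mpscoef1 m : mpscoef (1 : S) m = (m == 0%MM)%:R.
Proof. by []. Qed.

Lemma mpscoef_sum (I : Type) (r : seq I) (P : pred I) (F : I -> S) m :
  mpscoef (\sum_(i <- r | P i) F i) m = \sum_(i <- r | P i) mpscoef (F i) m.
Proof. exact: (big_morph (fun f => mpscoef f m)). Qed.

Lemma mpscoefM f g m : mpscoef (f * g) m =
  \sum_(k : 'X_{1..n < (mdeg m).+1, (mdeg m).+1} | m == (k.1 + k.2)%MM)
    mpscoef f k.1 * mpscoef g k.2.
Proof. by []. Qed.

Lemma mpscoefM0 f g : mpscoef (f * g) 0%MM = mpscoef f 0%MM * mpscoef g 0%MM.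
Proof.
pose T := @mps_trunc n R (mdeg (0 : 'X_{1..n})%MM).+1.
rewrite -[LHS]/(mpscoef (mps_mul f g) _).
rewrite (@mps_mul_poly _ _ _ f g (T f) (T g) _ (ltnSn _)); last 2 first.
- by move=> m'; exact: mcoeff_trunc.
- by move=> m'; exact: mcoeff_trunc.
by rewrite mcoeff0_is_multiplicative !mcoeff_trunc.
Qed.

(** Congruence modulo the d-th power of the ideal generated by the variables. *)
Definition agree d f g := forall m, (mdeg m < d)%N -> mpscoef f m = mpscoef g m.

Lemma agreeM d f f' g g' : agree d f f' -> agree d g g' ->
  agree d (f * g) (f' * g').
Proof.
move=> ff' gg' m md; rewrite !mpscoefM; apply: eq_bigr => -[k1 k2] /= _.
by rewrite ff' ?gg' // (leq_trans (bmdeg _) md).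
Qed.

Lemma mps_of_mpolyM (p q : {mpoly R[n]}) :
  mps_of_mpoly (p * q) = mps_of_mpoly p * mps_of_mpoly q.
Proof.
by apply/mpseriesP => m; rewrite [RHS](@mps_mul_poly _ _ (mdeg m).+1 _ _ p q).
Qed.

Definition mono m : S := mps_of_mpoly 'X_[m].

Lemma mpscoef_mono m m' : mpscoef (mono m) m' = (m == m')%:R.
Proof. exact: mcoeffX. Qed.

Lemma mpscoef_mulmono f m m' :
  mpscoef (f * mono m) m' = if (m <= m')%MM then mpscoef f (m' - m)%MM else 0.
Proof.
rewrite -[LHS]/(mpscoef (mps_mul f (mono m)) m').
have T m1 : (mdeg m1 < (mdeg m').+1)%N -> _ := @mcoeff_trunc _ _ _ f m1.
rewrite (@mps_mul_poly _ _ _ _ _ _ 'X_[m] _ (ltnSn _) T) //.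
case: ifP => [le|nle]; last first.
  rewrite mcoeffM big1 // => -[k1 k2] /= /eqP E.
  rewrite mcoeffX; case: eqP => [e|]; last by rewrite mulr0.
  by rewrite E e lem_addl in nle.
rewrite -[X in _@_X](submK le) addmC mcoeffMX mcoeff_trunc //.
by rewrite ltnS mdegB.
Qed.

Definition truncation d f : S := mps_of_mpoly (mps_trunc d f).

Lemma truncationE d f :
  truncation d f = \sum_(m : 'X_{1..n < d}) mpscoef f m *: mono m.
Proof.
apply/mpseriesP => m; rewrite mpscoef_sum /= raddf_sum /=.
by apply: eq_bigr => i _; rewrite mcoeffZ.
Qed.

Lemma agree_truncation d f : agree d f (truncation d f).
Proof. by move=> m md; rewrite /= mcoeff_trunc. Qed.

(* Geometric series: each coefficient of the inverse is that of a partial sum. *)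
Lemma unit_of_const1 f : mpscoef f 0%MM = 1 -> exists g, g * f = 1.
Proof.
move=> f1; pose u := 1 - f.
have u0 : mpscoef u 0%MM = 0 by rewrite mpscoefB f1 mpscoef1 eqxx subrr.
have uX i : agree i (u ^+ i) 0.
  elim: i => [//|i IH] m; rewrite ltnS exprS mpscoefM => md.
  rewrite big1 // => k /eqP E.
  have [k10|k1N0] := eqVneq (k.1 : 'X_{1..n}) 0%MM.
    by rewrite k10 u0 mul0r.
  have lt : (mdeg k.2 < mdeg (k.1 + k.2)%MM)%N.
    by rewrite mdegD -[X in (X < _)%N]add0n ltn_add2r lt0n mdeg_eq0.
  by rewrite IH ?mulr0 // (leq_trans _ md) // (leq_trans lt) // -E.
pose G d := \sum_(i < d) u ^+ i.
have GX m d : (mdeg m < d)%N -> mpscoef (G d) m = mpscoef (G (mdeg m).+1) m.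
  elim: d => // d IH; rewrite ltnS leq_eqVlt => /predU1P[-> //|lt].
  by rewrite /G big_ord_recr mpscoefD (uX d) // mpscoef0 addr0; exact: IH.
exists (MPSeries (fun m => mpscoef (G (mdeg m).+1) m)).
apply/mpseriesP => m; set g := MPSeries _.
have gG : agree (mdeg m).+1 g (G (mdeg m).+1).
  by move=> m' lt; rewrite (GX _ (mdeg m).+1).
have -> : mpscoef (g * f) m = mpscoef (G (mdeg m).+1 * f) m.
  by apply: (agreeM gG (fun _ _ => erefl)).
have -> : G (mdeg m).+1 * f = 1 - u ^+ (mdeg m).+1.
  by rewrite -[f](subKr 1) -/u mulrC -(opprB u) mulNr -subrX1 opprB.
by rewrite mpscoefB uX // mpscoef0 subr0.
Qed.

End Series.

(** * The constant term as a ring morphism *)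

Section ConstantTerm.
Variables (n : nat) (R : comNzRingType).

Definition const_term (f : mpseries n R) : R := mpscoef f 0%MM.

Lemma const_term_is_zmod_morphism : zmod_morphism const_term.
Proof. by []. Qed.

Lemma const_term_is_monoid_morphism : monoid_morphism const_term.
Proof.
split=> [|f g]; last exact: mpscoefM0.
by rewrite /const_term mpscoef1 eqxx.
Qed.

HB.instance Definition _ := GRing.isZmodMorphism.Build (mpseries n R) R
  const_term const_term_is_zmod_morphism.
HB.instance Definition _ := GRing.isMonoidMorphism.Build (mpseries n R) R
  const_term const_term_is_monoid_morphism.

End ConstantTerm.

(** * Ideals and the linear projection onto their quotients *)

Section IdealSpanTheory.
Variables (R : comNzRingType) (A : comAlgType R) (gs : seq A).

Lemma ideal_spanP x :
  reflect (exists c : 'I_(size gs) -> A, x = \sum_i c i * gs`_i)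
          (x \in ideal_span gs).
Proof. exact: asboolP. Qed.

Lemma ideal_spanMl y x : x \in ideal_span gs -> y * x \in ideal_span gs.
Proof.
case/ideal_spanP=> c ->; apply/ideal_spanP; exists (fun i => y * c i).
by rewrite mulr_sumr; apply: eq_bigr => i _; rewrite mulrA.
Qed.

Lemma ideal_span_gen (i : 'I_(size gs)) : gs`_i \in ideal_span gs.
Proof.
apply/ideal_spanP; exists (fun j => (j == i)%:R).
rewrite (bigD1 i) //= eqxx mul1r big1 ?addr0 // => j /negPf ->.
by rewrite mul0r.
Qed.

Definition quot_ideal_pi (x : A) : quot_ideal gs :=
  \pi_(Quotient.quot (ideal_span gs)) x.

Lemma quot_ideal_pi_is_linear : linear quot_ideal_pi.
Proof.
move=> a x y; rewrite /quot_ideal_pi raddfD; congr (_ + _).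
by symmetry; exact: quot_ideal_scale_pi.
Qed.

HB.instance Definition _ :=
  GRing.isLinear.Build R A (quot_ideal gs) _ quot_ideal_pi
    quot_ideal_pi_is_linear.

Lemma quot_ideal_pi_eq0 x : (quot_ideal_pi x == 0) = (x \in ideal_span gs).
Proof.
rewrite -[0](raddf0 quot_ideal_pi) /quot_ideal_pi -Quotient.idealrBE.
by rewrite subr0.
Qed.

End IdealSpanTheory.

(** * Nakayama's lemma for powers of the maximal ideal *)

Section Nakayama.
Variables (n : nat) (R : comNzRingType).
Local Notation S := (mpseries n R).
Implicit Types (f g h : S) (m : 'X_{1..n}).

(** Build the divisor one variable at a time: as long as its degree is below that of [m], some
    exponent can still grow. *)
Lemma mnm_sub_mdeg d m : (d <= mdeg m)%N -> exists2 b, (b <= m)%MM & mdeg b = d.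
Proof.
elim: d => [|d IH] dm.
  by exists 0%MM; [apply/mnm_lepP => i; rewrite mnm0E | rewrite mdeg0].
have [b bm bd] := IH (ltnW dm).
have /existsP[i bi] : [exists i, (b i < m i)%N].
  apply: contraLR dm => /existsPn ge; rewrite -leqNgt -bd !mdegE.
  by apply: leq_sum => i _; rewrite leqNgt.
exists (b + U_(i))%MM; last by rewrite mdegD mdeg1 bd addn1.
apply/mnm_lepP => j; rewrite mnmDE mnm1E; case: eqP => [<-|_].
  by rewrite addn1.
by rewrite addn0; exact: (mnm_lepP bm).
Qed.

(** The monomials of degree exactly d, padded with 0 in lower degrees so that the finite type of
    monomials of degree at most d can index them. *)
Definition top_mono d (b : 'X_{1..n < d.+1}) : S :=
  if mdeg b == d then mono R b else 0.

Lemma agree_top_mono d (b : 'X_{1..n < d.+1}) : agree d (top_mono b) 0.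
Proof.
move=> m md; rewrite /top_mono; case: eqP => // bd.
rewrite mpscoef_mono; case: eqP => // bm.
by rewrite -bm bd ltnn in md.
Qed.

(** Assign to each monomial of degree at least d one divisor [beta m] of degree d, and collect in
    [s b] the terms of [f] assigned to [b], divided by [b]. The constant term of [s b] is either 0
    or a coefficient of [f] in degree at most d. *)
Lemma top_mono_decomposition d f : agree d f 0 ->
  exists2 s : 'X_{1..n < d.+1} -> S, f = \sum_b s b * top_mono b &
    agree d.+1 f 0 -> forall b, const_term (s b) = 0.
Proof.
move=> f0.
have /choice[beta betaP] : forall m, exists b : 'X_{1..n},
    (d <= mdeg m)%N -> (b <= m)%MM /\ mdeg b = d.
  move=> m; case: (leqP d (mdeg m)) => [/mnm_sub_mdeg[b]|_]; first by exists b.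
  by exists 0%MM.
pose s (b : 'X_{1..n < d.+1}) : S := MPSeries (fun a =>
  if beta (a + b)%MM == b then mpscoef f (a + b)%MM else 0).
exists s; last first.
  move=> f1 b; rewrite /const_term /= add0m; case: eqP => // _.
  by rewrite f1 // bmdeg.
have sE b m : mpscoef (s b * top_mono b) m =
    if [&& mdeg b == d, (b <= m)%MM & beta m == b] then mpscoef f m else 0.
  rewrite /top_mono; case: eqP => _; last by rewrite mulr0.
  by rewrite mpscoef_mulmono; case: ifP => // le; rewrite /= submK.
apply/mpseriesP => m; rewrite mpscoef_sum; under eq_bigr do rewrite sE.
have [md|dm] := ltnP (mdeg m) d.
  by rewrite f0 // big1 // => b _; case: ifP.
have [bm bd] := betaP m dm.
have lt : (mdeg (beta m) < d.+1)%N by rewrite bd.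
rewrite (bigD1 (BMultinom lt)) //= bd bm !eqxx /= big1 ?addr0 // => b nb.
case: ifP => // /and3P[_ _ /eqP e]; case/eqP: nb.
by apply/val_inj; rewrite /= -e.
Qed.

(* The determinant trick: the top monomials satisfy a linear system modulo the
   ideal, whose matrix is the identity modulo the maximal ideal. *)
Lemma nakayama (gs : seq S) d :
  (forall f, agree d f 0 ->
     exists2 h, h \in ideal_span gs & agree d.+1 (f - h) 0) ->
  forall f, agree d f 0 -> f \in ideal_span gs.
Proof.
move=> hyp; pose T := 'X_{1..n < d.+1}.
suff xI (b : T) : top_mono b \in ideal_span gs.
  move=> f /top_mono_decomposition[s -> _].
  by apply: rpred_sum => b _; exact: ideal_spanMl.
have /choice[h hP] : forall c : T, exists h, h \in ideal_span gs /\
    agree d.+1 (top_mono c - h) 0.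
  by move=> c; have [h hI hc] := hyp _ (@agree_top_mono d c); exists h.
have /choice[s sP] : forall c : T, exists s : T -> S,
    top_mono c - h c = \sum_b s b * top_mono b /\
    forall b, const_term (s b) = 0.
  move=> c; have [_ a1] := hP c.
  have a0 : agree d (top_mono c - h c) 0 by move=> m md; exact: a1 (ltnW md).
  have [s e c0] := top_mono_decomposition a0.
  by exists s; split=> //; exact: c0.
pose A : 'M[S]_#|{: T}| := \matrix_(i, j)
  ((i == j)%:R - s (enum_val i) (enum_val j)).
pose x : 'cV[S]_#|{: T}| := \col_i top_mono (enum_val i).
have Ax : A *m x = \col_i h (enum_val i).
  apply/colP => i; rewrite !mxE; under eq_bigr do rewrite !mxE mulrBl.
  rewrite sumrB (bigD1 i) //= eqxx mul1r big1 ?addr0; last first.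
    by move=> j /negPf; rewrite eq_sym => ->; rewrite mul0r.
  have [e _] := sP (enum_val i).
  apply/eqP; rewrite subr_eq addrC -subr_eq e (reindex _ (onW_bij _ (enum_val_bij T))).
  by [].
(* Cramer's rule: applying the adjugate to [A *m x], whose entries lie in the ideal, leaves [\det A]
   times each top monomial. *)
have dx : \det A * top_mono b \in ideal_span gs.
  have -> : \det A * top_mono b = (\adj A *m (A *m x)) (enum_rank b) 0.
    by rewrite mulmxA mul_adj_mx mul_scalar_mx !mxE enum_rankK.
  rewrite Ax mxE; apply: rpred_sum => i _.
  by apply: ideal_spanMl; rewrite mxE; case: (hP (enum_val i)).
have dA : const_term (\det A) = 1.
  rewrite -det_map_mx (_ : map_mx _ A = 1%:M) ?det1 //.
  apply/matrixP => i j; rewrite !mxE raddfB /= rmorph_nat.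
  by have [_ ->] := sP (enum_val i); rewrite subr0.
have [g gA] := unit_of_const1 dA.
by rewrite -[top_mono b]mul1r -gA -mulrA ideal_spanMl.
Qed.

End Nakayama.

(** A sequence that is never stationary increases strictly, so [u d] is at least d, which fails at d
    = D + 1. *)
Lemma nondecreasing_bounded_stable (u : nat -> nat) D :
  (forall d, (u d <= u d.+1)%N) -> (forall d, (u d <= D)%N) ->
  exists d, u d = u d.+1.
Proof.
move=> incr bnd; apply: contrapT => /forallNP nst.
have ge d : (d <= u d)%N.
  elim: d => // d IH; apply: leq_ltn_trans IH _.
  by rewrite ltn_neqAle incr andbT; apply/eqP.
by have := ge D.+1; rewrite leqNgt ltnS bnd.
Qed.

(** * Jets and the codimension of an ideal modulo powers of the maximal ideal *)

Section Truncation.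
Variables (k : fieldType) (n : nat).
Local Notation S := (mpseries n k).
Local Notation T d := {: 'X_{1..n < d}}.
Implicit Types (f g h : S) (m : 'X_{1..n}) (gs : seq S).

(** The class modulo the d-th power of the maximal ideal, written as a row vector so that matrix
    ranks compute dimensions. *)
Definition jet d f : 'rV[k]_#|T d| :=
  \row_j mpscoef f (enum_val j : 'X_{1..n < d}).

Lemma jet_is_linear d : linear (jet d).
Proof. by move=> a f g; apply/rowP => j; rewrite !mxE. Qed.

HB.instance Definition _ d :=
  GRing.isLinear.Build k S 'rV[k]_#|T d| _ (jet d) (@jet_is_linear d).

Lemma eq_jet d f g : jet d f = jet d g <-> agree d f g.
Proof.
split=> [/rowP fg m md|fg]; last by apply/rowP => j; rewrite !mxE fg ?bmdeg.
have := fg (enum_rank (BMultinom md : 'X_{1..n < d})).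
by rewrite !mxE enum_rankK.
Qed.

(** The polynomial representative of degree < d of a jet. *)
Definition of_jet d (v : 'rV[k]_#|T d|) : S :=
  \sum_j v 0 j *: mono k (enum_val j : 'X_{1..n < d}).

Lemma of_jetK d : cancel (@of_jet d) (jet d).
Proof.
move=> v; apply/rowP => i; rewrite mxE mpscoef_sum.
under eq_bigr do rewrite mpscoefZ mpscoef_mono.
rewrite (bigD1 i) //= eqxx mulr1 big1 ?addr0 // => j ji.
case: eqP => [e|_]; last by rewrite mulr0.
by case/eqP: ji; apply/enum_val_inj/val_inj.
Qed.

Lemma of_jet_is_linear d : linear (@of_jet d).
Proof.
move=> a u v; rewrite /of_jet scaler_sumr -big_split /=.
by apply: eq_bigr => j _; rewrite !mxE scalerDl scalerA.
Qed.

HB.instance Definition _ d :=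
  GRing.isLinear.Build k 'rV[k]_#|T d| S _ (@of_jet d) (@of_jet_is_linear d).

(* Meant for r = size gs: as a separate parameter it gives the matrices of all
   reductions of the same integer polynomials one and the same type. *)
Definition ideal_mx r gs d : 'M[k]_(#|{: 'X_{1..n < d} * 'I_r}|, #|T d|) :=
  \matrix_(p < #|{: 'X_{1..n < d} * 'I_r}|)
    jet d (mono k (enum_val p).1 * gs`_(enum_val p).2).

(** Terms of degree at least d in the coefficients do not affect the jet, so the multiples of the
    generators by monomials of degree < d span the jets of the ideal. *)
Lemma sub_ideal_mxP gs d (v : 'rV[k]_#|T d|) :
  (v <= ideal_mx (size gs) gs d)%MS <->
  exists2 h, h \in ideal_span gs & jet d h = v.
Proof.
split=> [/submxP[D ->]|[h /ideal_spanP[c ->] <-]].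
  exists (\sum_p D 0 p *: (mono k (enum_val p).1 * gs`_(enum_val p).2)).
    apply: rpred_sum => p _; apply: rpredZ; apply: ideal_spanMl.
    exact: ideal_span_gen.
  rewrite linear_sum mulmx_sum_row; apply: eq_bigr => p _.
  by rewrite linearZ rowK.
rewrite linear_sum; apply: summx_sub => i _ /=.
have /eq_jet -> : agree d (c i * gs`_i) (truncation d (c i) * gs`_i).
  exact: agreeM (@agree_truncation _ _ _ _) (fun _ _ => erefl).
rewrite truncationE mulr_suml linear_sum; apply: summx_sub => a _ /=.
rewrite -scalerAl linearZ; apply: scalemx_sub.
apply: (eq_row_sub (enum_rank (a, i))).
by rewrite rowK enum_rankK.
Qed.

(** For r = size gs, this is the dimension of the quotient by the ideal plus the d-th power of the
    maximal ideal. *)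
Definition codim r gs d := (#|T d| - \rank (ideal_mx r gs d))%N.

Definition jet_proj d : 'M[k]_(#|T d.+1|, #|T d|) :=
  \matrix_(i < #|T d.+1|, j < #|T d|)
    (bmnm (enum_val i : 'X_{1..n < d.+1}) ==
     bmnm (enum_val j : 'X_{1..n < d}))%:R.

Lemma jet_projE d f : jet d.+1 f *m jet_proj d = jet d f.
Proof.
apply/rowP => j; rewrite !mxE.
have lt : (mdeg (enum_val j : 'X_{1..n}) < d.+1)%N.
  by apply: leqW; exact: bmdeg.
rewrite (bigD1 (enum_rank (BMultinom lt))) //= !mxE enum_rankK eqxx mulr1.
rewrite big1 ?addr0 // => i ni; rewrite !mxE.
case: eqP => [e|_]; last by rewrite mulr0.
case/eqP: ni; apply: enum_val_inj; rewrite enum_rankK.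
exact: val_inj.
Qed.

(** Every jet of order d is the jet of a polynomial, whose jet of order d + 1 is a preimage. *)
Lemma jet_proj_full d : row_full (jet_proj d).
Proof.
rewrite -sub1mx; apply/row_subP => i.
by rewrite -[row i _]of_jetK -jet_projE submxMl.
Qed.

Lemma ideal_mx_proj gs d :
  (ideal_mx (size gs) gs d.+1 *m jet_proj d :=: ideal_mx (size gs) gs d)%MS.
Proof.
apply/eqmxP/andP; split; apply/row_subP => i.
  rewrite row_mul; have /sub_ideal_mxP[h hI <-] := row_sub i
    (ideal_mx (size gs) gs d.+1).
  by rewrite jet_projE; apply/sub_ideal_mxP; exists h.
have /sub_ideal_mxP[h hI <-] := row_sub i (ideal_mx (size gs) gs d).
by rewrite -jet_projE submxMr //; apply/sub_ideal_mxP; exists h.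
Qed.

(** Rank-nullity for [jet_proj] restricted to the jets of the ideal. *)
Lemma rank_ideal_mxS gs d (A := ideal_mx (size gs) gs d.+1) :
  (\rank (ideal_mx (size gs) gs d) +
   \rank (A :&: kermx (jet_proj d))%MS = \rank A)%N.
Proof. by rewrite -(ideal_mx_proj gs d) mxrank_mul_ker. Qed.

Lemma rank_ker_jet_proj d :
  (#|T d| + \rank (kermx (jet_proj d)) = #|T d.+1|)%N.
Proof.
have /eqP rP := jet_proj_full d.
by rewrite mxrank_ker rP subnKC // -{1}rP rank_leq_row.
Qed.

(** From d to d + 1 the number of monomials grows by the dimension of the kernel of [jet_proj], and
    the rank only by that of its intersection with the jets of the ideal. *)
Lemma codim_leqS gs d : (codim (size gs) gs d <= codim (size gs) gs d.+1)%N.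
Proof.
have := mxrankS (capmxSr (ideal_mx (size gs) gs d.+1) (kermx (jet_proj d))).
have := rank_ker_jet_proj d; have := rank_ideal_mxS gs d.
by have := rank_leq_col (ideal_mx (size gs) gs d); rewrite /codim; lia.
Qed.

(** Equality forces the jets of the ideal to contain the whole kernel of [jet_proj]: modulo degree d
    + 1, every series starting in degree d lies in the ideal, and [nakayama] applies. *)
Lemma codim_stable gs d : codim (size gs) gs d = codim (size gs) gs d.+1 ->
  forall f, agree d f 0 -> f \in ideal_span gs.
Proof.
move=> eqc; apply: nakayama => f f0.
have ker_sub : (kermx (jet_proj d) <= ideal_mx (size gs) gs d.+1)%MS.
  apply: submx_trans (capmxSl _ (kermx (jet_proj d))).
  (* The intersection fills the kernel once their ranks agree; the column bounds below make the
     truncated subtractions in [codim] exact. *)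
  rewrite -(geq_leqif (mxrank_leqif_sup (capmxSr _ _))).
  have := rank_leq_col (ideal_mx (size gs) gs d.+1).
  have := rank_leq_col (ideal_mx (size gs) gs d); move: eqc; rewrite /codim.
  by have := rank_ker_jet_proj d; have := rank_ideal_mxS gs d; lia.
have /submx_trans/(_ ker_sub)/sub_ideal_mxP[h hI hf] :
    (jet d.+1 f <= kermx (jet_proj d))%MS.
  apply/sub_kermxP; rewrite jet_projE -[RHS](linear0 (jet d)).
  exact/eq_jet.
exists h => //; rewrite -[0](subrr f); apply/eq_jet.
by rewrite !linearB /= hf.
Qed.

(** The quotient depends only on jets of order d, so a basis of a complement of the jets of the
    ideal lifts to a basis of it. *)
Lemma has_dim_codim gs d :
  (forall f, agree d f 0 -> f \in ideal_span gs) ->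
  has_dim (quot_ideal gs) (codim (size gs) gs d).
Proof.
move=> hyp; set M := ideal_mx (size gs) gs d.
have <- : \rank M^C%MS = codim (size gs) gs d by rewrite mxrank_compl.
pose Q := row_base M^C%MS.
have combE c : of_jet (c *m Q) = \sum_i c 0 i *: of_jet (row i Q).
  by rewrite mulmx_sum_row linear_sum; apply: eq_bigr => i _; rewrite linearZ.
exists (fun i => quot_ideal_pi gs (of_jet (row i Q))); split=> [c|x].
  under eq_bigr do rewrite -linearZ.
  rewrite -linear_sum => /eqP; rewrite quot_ideal_pi_eq0.
  pose u := \row_i c i.
  have -> : \sum_i c i *: of_jet (row i Q) = of_jet (u *m Q).
    by rewrite combE; apply: eq_bigr => i _; rewrite mxE.
  move=> uI i; suff : u *m Q = 0.
    rewrite -[RHS](mul0mx _ Q) => /(row_free_inj (row_base_free _))/rowP/(_ i).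
    by rewrite !mxE.
  (* Independence: the jet of a combination lying in the ideal belongs both to [M] and to its
     complement. *)
  apply/eqP; rewrite -submx0 -(capmx_compl M) sub_capmx.
  apply/andP; split; last by rewrite (submx_trans (submxMl u Q)) ?eq_row_base.
  by apply/sub_ideal_mxP; exists (of_jet (u *m Q)); rewrite ?of_jetK.
have [f ->] := quot_ideal_pi_surj x.
(* Spanning: split the jet of [f] along [M] and its complement. The part in [M] comes from some [h]
   in the ideal, and what remains has zero jet, so [hyp] absorbs it. *)
have /sub_addsmxP[[b c] /= fE] : (jet d f <= M + M^C)%MS.
  exact: submx_full (addsmx_compl_full M).
have /sub_ideal_mxP[h hI hE] : (b *m M <= M)%MS by exact: submxMl.
have /submxP[a aE] : (c *m M^C%MS <= Q)%MS by rewrite eq_row_base submxMl.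
exists (a 0); under eq_bigr do rewrite -linearZ.
rewrite -linear_sum -combE; apply/eqP; rewrite -subr_eq0.
rewrite -(linearB (quot_ideal_pi gs)) quot_ideal_pi_eq0 -(subrK h (f - _)) rpredD //.
apply: hyp; rewrite -[0](subrr f); apply/eq_jet.
by rewrite !linearB /= of_jetK hE fE aE addrK !subrr.
Qed.

(** Lifts of D elements spanning the quotient, together with the ideal, span all jets; hence the
    number of monomials is at most the rank of [M] plus D. *)
Lemma codim_le_dim gs D d :
  has_dim (quot_ideal gs) D -> (codim (size gs) gs d <= D)%N.
Proof.
case=> e [_ span]; set M := ideal_mx (size gs) gs d.
have /choice[f fE] i := quot_ideal_pi_surj (e i).
pose E : 'M[k]_(D, #|T d|) := \matrix_(i < D) jet d (f i).
suff /eqP full : row_full (M + E)%MS.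
  rewrite /codim leq_subLR -[X in (X <= _)%N]full.
  rewrite (leq_trans (mxrank_adds_leqif M E)) //.
  by rewrite leq_add2l rank_leq_row.
rewrite -sub1mx; apply/row_subP => j; set v := row j _.
have [c cE] := span (quot_ideal_pi gs (of_jet v)).
have : of_jet v - \sum_i c i *: f i \in ideal_span gs.
  rewrite -quot_ideal_pi_eq0 linearB [X in X - _]cE linear_sum subr_eq0.
  by apply/eqP; apply: eq_bigr => i _; rewrite linearZ fE.
move=> hI; rewrite -[v]of_jetK -[of_jet v](subrK (\sum_i c i *: f i)).
rewrite linearD addmx_sub_adds //.
  by apply/sub_ideal_mxP; eexists; first exact: hI.
rewrite linear_sum; apply: summx_sub => i _; rewrite linearZ scalemx_sub //.
by apply: (eq_row_sub i); rewrite rowK.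
Qed.

Lemma codim_bounded_stable gs D : (forall d, (codim (size gs) gs d <= D)%N) ->
  exists d, codim (size gs) gs d = codim (size gs) gs d.+1.
Proof. by apply: nondecreasing_bounded_stable => d; exact: codim_leqS. Qed.

End Truncation.

Lemma enat_le_refl x : enat_le x x.
Proof. by case: x => //= m. Qed.

(** * Comparison of the quotient dimensions over the rationals and over prime fields *)

Section Reduction.
Variables (n : nat) (G : seq {mpoly int[n]}).

Definition image_gens (k : fieldType) : seq (mpseries n k) :=
  [seq series_image k F | F <- G].

(** Common form of both invariants: [G] will be the list of partial derivatives, preceded by the
    polynomial itself for the Tjurina number. *)
Definition quot_dim (k : fieldType) : enat :=
  lmod_dim (quot_ideal (image_gens k)).

Lemma series_imageM (k : fieldType) (F H : {mpoly int[n]}) :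
  series_image k (F * H) = series_image k F * series_image k H.
Proof. by rewrite /series_image rmorphM mps_of_mpolyM. Qed.

Lemma series_imageX (k : fieldType) (m : 'X_{1..n}) :
  series_image k 'X_[m] = mono k m.
Proof. by rewrite /series_image map_mpolyX. Qed.

Definition int_ideal_mx d :
    'M[int]_(#|{: 'X_{1..n < d} * 'I_(size G)}|, #|{: 'X_{1..n < d}}|) :=
  \matrix_(p < #|{: 'X_{1..n < d} * 'I_(size G)}|, j < #|{: 'X_{1..n < d}}|)
    ('X_[(enum_val p).1] * G`_(enum_val p).2)@_(enum_val j : 'X_{1..n < d}).

Lemma ideal_mx_image (k : fieldType) d :
  ideal_mx (size G) (image_gens k) d = map_mx intr (int_ideal_mx d).
Proof.
apply/matrixP => p j; rewrite !mxE (nth_map 0) ?ltn_ord //.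
by rewrite -series_imageX -series_imageM /= mcoeff_map_mpoly.
Qed.

Lemma codim_image (k : fieldType) d :
  codim (size (image_gens k)) (image_gens k) d =
  (#|{: 'X_{1..n < d}}| - \rank (map_mx intr (int_ideal_mx d) : 'M[k]_(_, _)))%N.
Proof. by rewrite size_map /codim ideal_mx_image. Qed.

Lemma quot_dim_finite (k : fieldType) : quot_dim k <> Infty ->
  exists2 D, has_dim (quot_ideal (image_gens k)) D & quot_dim k = Fin D.
Proof.
rewrite /quot_dim {1}/lmod_dim; case: pselect => [[D hD] _|//].
by exists D => //; exact: lmod_dimE.
Qed.

(** The stationary index is returned with the dimension, since comparing with another field requires
    the ranks at d and d + 1. *)
Lemma quot_dim_bounded (k : fieldType) D :
  (forall d, (codim (size (image_gens k)) (image_gens k) d <= D)%N) ->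
  exists2 d, codim (size (image_gens k)) (image_gens k) d =
    codim (size (image_gens k)) (image_gens k) d.+1 &
  quot_dim k = Fin (codim (size (image_gens k)) (image_gens k) d).
Proof.
case/codim_bounded_stable=> d e; exists d => //; apply: lmod_dimE.
exact: has_dim_codim (codim_stable e).
Qed.

(** Passing to the rationals can only raise ranks, so a finite dimension over [k] bounds every
    rational codimension. *)
Lemma quot_dim_rat_le (k : fieldType) : quot_dim k <> Infty ->
  enat_le (quot_dim rat) (quot_dim k).
Proof.
case/quot_dim_finite=> D hD ->.
have le d : (codim (size (image_gens rat)) (image_gens rat) d <= D)%N.
  apply: leq_trans (codim_le_dim d hD); rewrite !codim_image.
  by rewrite leq_sub2l ?rank_intr_le.
by have [d _ ->] := quot_dim_bounded le; exact: le.
Qed.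

Lemma quot_dim_Fp_eq : quot_dim rat <> Infty ->
  exists B, forall q, prime q -> (B < q)%N -> quot_dim 'F_q = quot_dim rat.
Proof.
case/quot_dim_finite=> D hD _.
have [d e ->] := quot_dim_bounded (fun d => codim_le_dim d hD).
have [B hB] := rank_Fp_rat (int_ideal_mx d).
have [B' hB'] := rank_Fp_rat (int_ideal_mx d.+1).
(* Beyond both bounds the codimensions at d and d + 1 are the rational ones, so they are stationary
   over ['F_q] at the same d. *)
exists (maxn B B') => q qp; rewrite gtn_max => /andP[Bq B'q].
have eq_codim d' : \rank (map_mx intr (int_ideal_mx d') : 'M['F_q]_(_, _)) =
    \rank (map_mx intr (int_ideal_mx d') : 'M[rat]_(_, _)) ->
    codim (size (image_gens 'F_q)) (image_gens 'F_q) d' =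
    codim (size (image_gens rat)) (image_gens rat) d'.
  by rewrite !codim_image => ->.
have eq0 := eq_codim _ (hB _ qp Bq); have eq1 := eq_codim _ (hB' _ qp B'q).
rewrite -eq0; apply: lmod_dimE; apply: has_dim_codim.
by apply: codim_stable; rewrite eq0 eq1.
Qed.

Lemma quot_dim_semicontinuity :
  (forall p : nat, prime p -> quot_dim 'F_p <> Infty ->
     enat_le (quot_dim rat) (quot_dim 'F_p) /\
     finite_set [set q : nat |
       prime q /\ ~ enat_le (quot_dim 'F_q) (quot_dim 'F_p)]%classic) /\
  ((exists p : nat, prime p /\ quot_dim 'F_p <> Infty) ->
     quot_dim rat <> Infty) /\
  (quot_dim rat <> Infty ->
     finite_set [set q : nat |
       prime q /\ ~ enat_le (quot_dim 'F_q) (quot_dim rat)]%classic /\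
     finite_set [set q : nat |
       prime q /\ quot_dim rat <> quot_dim 'F_q]%classic).
Proof.
have fin p : quot_dim 'F_p <> Infty -> quot_dim rat <> Infty.
  by move=> fp e; have := quot_dim_rat_le fp; rewrite e; case: quot_dim fp.
(* A property that fails whenever the dimension over ['F_q] is the rational one can hold only for
   primes up to the bound of [quot_dim_Fp_eq]. *)
have bounded (P : nat -> Prop) : quot_dim rat <> Infty ->
    (forall q, quot_dim 'F_q = quot_dim rat -> ~ P q) ->
    finite_set [set q : nat | prime q /\ P q]%classic.
  move=> /quot_dim_Fp_eq[B hB] nP; apply: sub_finite_set (finite_II B.+1).
  move=> q /= [qp Pq]; rewrite ltnS leqNgt; apply/negP => Bq.
  exact: nP (hB q qp Bq) Pq.
split=> [p pp fp|]; [split; first exact: quot_dim_rat_le|split].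
- by apply: (bounded _ (fin p fp)) => q ->; apply; exact: quot_dim_rat_le.
- by case=> p [_ /fin].
- move=> f0; split; apply: bounded => // q ->; last by [].
  by apply; exact: enat_le_refl.
Qed.

End Reduction.

(** * Application to the Milnor and Tjurina numbers *)

Lemma partials_series_image (k : fieldType) (n : nat) (F : {mpoly int[n]}) :
  partials (series_image k F) = image_gens [seq F^`M(i) | i : 'I_n] k.
Proof.
rewrite /partials /image_gens -map_comp; apply: eq_map => i.
by apply/mpseriesP => m /=; rewrite !mcoeff_map_mpoly mcoeff_deriv raddfMn.
Qed.

Unset Implicit Arguments.
Local Open Scope classical_set_scope.

Theorem corollary64 (n : nat) (F : {mpoly int[n]}) :
  let Fp (p : nat) := series_image 'F_p F in
  let F0 := series_image rat F in
  ((forall p : nat, prime p -> milnor (Fp p) <> Infty ->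
      enat_le (milnor F0) (milnor (Fp p)) /\
      finite_set [set q : nat |
        prime q /\ ~ enat_le (milnor (Fp q)) (milnor (Fp p))]) /\
   ((exists p : nat, prime p /\ milnor (Fp p) <> Infty) ->
      milnor F0 <> Infty) /\
   (milnor F0 <> Infty ->
      finite_set [set q : nat |
        prime q /\ ~ enat_le (milnor (Fp q)) (milnor F0)] /\
      finite_set [set q : nat | prime q /\ milnor F0 <> milnor (Fp q)])) /\
  ((forall p : nat, prime p -> tjurina (Fp p) <> Infty ->
      enat_le (tjurina F0) (tjurina (Fp p)) /\
      finite_set [set q : nat |
        prime q /\ ~ enat_le (tjurina (Fp q)) (tjurina (Fp p))]) /\
   ((exists p : nat, prime p /\ tjurina (Fp p) <> Infty) ->
      tjurina F0 <> Infty) /\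
   (tjurina F0 <> Infty ->
      finite_set [set q : nat |
        prime q /\ ~ enat_le (tjurina (Fp q)) (tjurina F0)] /\
      finite_set [set q : nat | prime q /\ tjurina F0 <> tjurina (Fp q)])).
Proof.
move=> Fp F0; pose dF := [seq F^`M(i) | i : 'I_n].
(* The identification is stated between functions of the field, so that one rewriting covers the
   rationals and all ['F_q] under the quantifiers. *)
have mE : (fun k => milnor (series_image k F)) = quot_dim dF.
  by apply: funext => k; rewrite /milnor partials_series_image.
have tE : (fun k => tjurina (series_image k F)) = quot_dim (F :: dF).
  by apply: funext => k; rewrite /tjurina partials_series_image.
by split; [have := quot_dim_semicontinuity dF; rewrite -mE
          |have := quot_dim_semicontinuity (F :: dF); rewrite -tE].
Qed.
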